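(* Let $\mathfrak{g}=\mathfrak{g}_{\bar 0}\oplus\mathfrak{g}_{\bar 1}=\mathfrak{psl}(n|n)$ with $n>1$, let $\lambda=(\lambda_1\ge\dots\ge\lambda_{r+s})$ be a partition of $(n|n)$, and let $e\in\mathfrak{g}_{\bar 0}$ be a nilpotent element with Jordan type $\lambda$. Then $\mathfrak{z}(\mathfrak{g}^e)=\mathrm{Span}\{e,e^2,\dots,e^{\lambda_1-1}\}$.
   Context: $\mathfrak{psl}(n|n)=\mathfrak{sl}(n|n)/\mathbb{C}I_{n|n}$ over $\mathbb{C}$, where $\mathfrak{sl}(n|n)$ is the supertrace zero part of $\mathfrak{gl}(n|n)=\mathrm{End}(V_{\bar 0}\oplus V_{\bar 1})$, $\dim V_{\bar 0}=\dim V_{\bar 1}=n$. $\mathfrak{g}^e=\{x\in\mathfrak{g}:[e,x]=0\}$ and $\mathfrak{z}(\mathfrak{g}^e)$ is its centre. Let $\underline{e}\in\mathfrak{sl}(n|n)_{\bar 0}$ be the nilpotent lift of $e$. Its Jordan type is $\lambda$: the Jordan block sizes of $\underline e$ on $V_{\bar 0}$ ($r$ blocks) and on $V_{\bar 1}$ ($s$ blocks), merged in non-increasing order $\lambda_1\ge\dots\ge\lambda_{r+s}$. Here $e^k$ denotes the image in $\mathfrak{psl}(n|n)$ of the matrix power $\underline{e}^k$; the span is $0$ if $\lambda_1=1$. *)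

(* Defs.v *)
From HB Require Import structures.
From mathcomp Require Import all_boot all_order all_algebra.
From mathcomp Require Import boolp classical_sets reals.
From mathcomp Require Export complex.

Set Implicit Arguments.
Unset Strict Implicit.
Unset Printing Implicit Defensive.
Import GRing.Theory.
Local Open Scope ring_scope.
Local Open Scope quotient_scope.

Section GeneralLinear.
Variables (F : fieldType) (m n : nat).
Implicit Types x y : 'M[F]_(m + n).

(* gl(m|n) is 'M[F]_(m + n), acting on column vectors of F^m (+) F^n;
   parities are booleans, with true standing for the odd one. *)
Definition hpart (a : bool) x : 'M[F]_(m + n) :=
  if a then block_mx 0 (ursubmx x) (dlsubmx x) 0
  else block_mx (ulsubmx x) 0 0 (drsubmx x).

Definition supertrace x : F := \tr (ulsubmx x) - \tr (drsubmx x).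

(* [x, y] = x y - (-1)^(|x||y|) y x on homogeneous elements, extended
   bilinearly. *)
Definition sbracket x y : 'M[F]_(m + n) :=
  \sum_(a : bool) \sum_(b : bool)
    (hpart a x *m hpart b y
     - (-1) ^+ (a && b) *: (hpart b y *m hpart a x)).

Lemma hpart_is_linear a : linear (hpart a).
Proof.
move=> c x y; case: a; rewrite /hpart scale_block_mx add_block_mx
  /ulsubmx /ursubmx /dlsubmx /drsubmx !(linearD, linearZ) /= !scaler0 !addr0 //.
Qed.

HB.instance Definition _ a :=
  GRing.isLinear.Build F _ _ _ (hpart a) (hpart_is_linear a).

Lemma supertrace_is_scalar : scalar supertrace.
Proof.
move=> c x y; rewrite /supertrace /ulsubmx /drsubmx !linearP /= mulrBr opprD.
by rewrite addrACA.
Qed.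

HB.instance Definition _ :=
  GRing.isLinear.Build F _ _ _ supertrace supertrace_is_scalar.

Lemma hpartD x : hpart false x + hpart true x = x.
Proof.
by rewrite /hpart add_block_mx !addr0 !add0r submxK.
Qed.

Lemma supertrace_sbracket x y : supertrace (sbracket x y) = 0.
Proof.
rewrite /sbracket !big_bool /= !linearD /= !linearN /= !linearZ /= /supertrace.
rewrite /hpart !mulmx_block !block_mxKul !block_mxKdr.
rewrite !(mul0mx, mulmx0, add0r, addr0) !(mxtrace0, subrr, mulr0).
rewrite [\tr (ulsubmx y *m _)]mxtrace_mulC [\tr (drsubmx y *m _)]mxtrace_mulC.
rewrite [\tr (dlsubmx y *m _)]mxtrace_mulC [\tr (ursubmx y *m _)]mxtrace_mulC.
rewrite expr0 expr1 mul1r mulN1r opprK subrr !addr0.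
by rewrite addrA subrK subrr.
Qed.

Lemma sbracketDl x1 x2 y :
  sbracket (x1 + x2) y = sbracket x1 y + sbracket x2 y.
Proof.
rewrite /sbracket -big_split; apply: eq_bigr => a _.
rewrite -big_split; apply: eq_bigr => b _ /=.
by rewrite linearD /= mulmxDl mulmxDr scalerDr opprD addrACA.
Qed.

Lemma sbracketDr x y1 y2 :
  sbracket x (y1 + y2) = sbracket x y1 + sbracket x y2.
Proof.
rewrite /sbracket -big_split; apply: eq_bigr => a _.
rewrite -big_split; apply: eq_bigr => b _ /=.
by rewrite linearD /= mulmxDl mulmxDr scalerDr opprD addrACA.
Qed.

Lemma hpart_scalar a c : hpart a c%:M = if a then 0 else c%:M.
Proof.
rewrite /hpart (@scalar_mx_block _ m n c).
rewrite block_mxKul block_mxKur block_mxKdl block_mxKdr.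
by case: a; rewrite ?block_mx0.
Qed.

Lemma sbracket_scalarl c y : sbracket c%:M y = 0.
Proof.
rewrite /sbracket !big_bool !hpart_scalar /=.
rewrite !(mul0mx, mulmx0, scaler0, subr0, oppr0, add0r) !expr0 !scale1r.
by rewrite !mul_scalar_mx !mul_mx_scalar !subrr addr0.
Qed.

Lemma sbracket_scalarr c x : sbracket x c%:M = 0.
Proof.
rewrite /sbracket !big_bool !hpart_scalar /=.
rewrite !(mul0mx, mulmx0, scaler0, subr0, oppr0, add0r) !expr0 !scale1r.
by rewrite !mul_scalar_mx !mul_mx_scalar !subrr addr0.
Qed.

Lemma scalar_mx_supertrace c : m = n -> supertrace c%:M = 0.
Proof.
move=> mn; rewrite /supertrace (@scalar_mx_block _ m n c) block_mxKul block_mxKdr.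
by rewrite !mxtrace_scalar mn subrr.
Qed.

End GeneralLinear.

Lemma mxtrace_nilpotent (F : fieldType) (n : nat) (A : 'M[F]_n) :
  (exists l, A ^+ l = 0) -> \tr A = 0.
Proof.
case: n A => [|n] A [l Al0]; first by rewrite /mxtrace big_ord0.
pose X : 'M[{poly F}]_n.+1 := 'X%:M; pose B := map_mx (@polyC F) A.
have cXB : GRing.comm X B.
  by rewrite /GRing.comm -!mulmxE mul_scalar_mx mul_mx_scalar.
have Bl0 : B ^+ l = 0 by rewrite -rmorphXn /= Al0 rmorph0.
have := congr1 determinant (subrXX_comm l cXB).
rewrite Bl0 subr0 -rmorphXn /= det_scalar -exprM -mulmxE det_mulmx -/(char_poly A) => dX.
have : char_poly A %| ('X - 0%:P) ^+ (l * n.+1) by rewrite subr0 dX dvdp_mulr.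
move=> /dvdp_exp_XsubCP[k _]; rewrite subr0 eqp_monic ?char_poly_monic ?monicXn //.
move=> /eqP cE; have := size_char_poly A; rewrite cE size_polyXn => -[kn].
have := char_poly_trace A isT; rewrite cE kn coefXn /= ltn_eqF // => /esym/eqP.
by rewrite oppr_eq0 => /eqP.
Qed.

Lemma mxtrace_nilpotent_exp (F : fieldType) (n : nat) (A : 'M[F]_n) (k : nat) :
  (0 < k)%N -> (exists l, A ^+ l = 0) -> \tr (A ^+ k) = 0.
Proof.
move=> k0 [l Al0]; apply: mxtrace_nilpotent; exists l.
by case: k k0 => // k _; rewrite -exprM mulnC exprM Al0 exprS mul0r.
Qed.

Section SpecialLinear.
Variables (F : fieldType) (n : nat).

Definition sl_pred : {pred 'M[F]_(n + n)} := fun x => supertrace x == 0.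

Lemma sl_pred_submod_closed : submod_closed sl_pred.
Proof.
split=> [|c x y]; rewrite !unfold_in ?raddf0 //.
by move=> /eqP x0 /eqP y0; rewrite linearP /= x0 y0 mulr0 addr0.
Qed.

HB.instance Definition _ :=
  GRing.isSubmodClosed.Build F 'M[F]_(n + n) sl_pred sl_pred_submod_closed.

Record sl := Sl { sl_mx :> 'M[F]_(n + n); sl_mxP : sl_mx \in sl_pred }.

HB.instance Definition _ := [isSub for sl_mx].
HB.instance Definition _ := [Choice of sl by <:].
HB.instance Definition _ := [SubChoice_isSubLmodule of sl by <:].

Lemma slbracket_subproof (x y : sl) : sbracket (val x) (val y) \in sl_pred.
Proof. by rewrite unfold_in supertrace_sbracket. Qed.

Definition slbracket (x y : sl) : sl := Sl (slbracket_subproof x y).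

Definition sl_hom (a : bool) (x : sl) : Prop := hpart a (val x) = val x.

(* The ideal F I_(n|n) of sl(n|n). *)
Definition sl_scalar : {pred sl} := fun x => is_scalar_mx (val x).

Lemma sl_scalar_zmod_closed : zmod_closed sl_scalar.
Proof.
split=> [|x y]; rewrite !unfold_in /=; first exact: mx0_is_scalar.
move=> /is_scalar_mxP[a ->] /is_scalar_mxP[b ->].
by rewrite -raddfB scalar_mx_is_scalar.
Qed.

HB.instance Definition _ :=
  GRing.isZmodClosed.Build sl sl_scalar sl_scalar_zmod_closed.

Definition psl := Quotient.quot sl_scalar.

HB.instance Definition _ := GRing.Zmodule.on psl.
HB.instance Definition _ := EqQuotient.on psl.

Definition psl_pi (x : sl) : psl := \pi_psl x.

Lemma psl_piB : zmod_morphism psl_pi.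
Proof. by move=> x y; rewrite /psl_pi !piE. Qed.

HB.instance Definition _ :=
  GRing.isZmodMorphism.Build sl psl psl_pi psl_piB.

Lemma psl_piP (x y : sl) :
  reflect (exists c : F, val x - val y = c%:M) (psl_pi x == psl_pi y).
Proof. by rewrite -Quotient.idealrBE; apply: is_scalar_mxP. Qed.

Lemma psl_pi_surj (z : psl) : exists x, psl_pi x = z.
Proof. by exists (repr z); apply: reprK. Qed.

Definition psl_scale (c : F) (z : psl) : psl := psl_pi (c *: repr z).

Lemma psl_pi_scale c x : psl_scale c (psl_pi x) = psl_pi (c *: x).
Proof.
apply/eqP/psl_piP.
have /eqP/psl_piP[d hd] : psl_pi (repr (psl_pi x)) = psl_pi x by apply: reprK.
by exists (c * d); rewrite !linearZ /= -scalerDr hd scale_scalar_mx.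
Qed.

Lemma psl_scaleA a b v : psl_scale a (psl_scale b v) = psl_scale (a * b) v.
Proof. by have [x <-] := psl_pi_surj v; rewrite !psl_pi_scale scalerA. Qed.

Lemma psl_scale1 : left_id 1 psl_scale.
Proof.
by move=> v; have [x <-] := psl_pi_surj v; rewrite psl_pi_scale scale1r.
Qed.

Lemma psl_scaleDr : right_distributive psl_scale +%R.
Proof.
move=> a u v; have [x <-] := psl_pi_surj u; have [y <-] := psl_pi_surj v.
by rewrite -raddfD !psl_pi_scale scalerDr raddfD.
Qed.

Lemma psl_scaleDl v : {morph psl_scale^~ v : a b / a + b}.
Proof.
move=> a b; have [x <-] := psl_pi_surj v.
by rewrite !psl_pi_scale scalerDl raddfD.
Qed.

HB.instance Definition _ := GRing.Zmodule_isLmodule.Build F psl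
  psl_scaleA psl_scale1 psl_scaleDr psl_scaleDl.

Definition psl_bracket (u v : psl) : psl :=
  psl_pi (slbracket (repr u) (repr v)).

Lemma psl_pi_bracket x y :
  psl_bracket (psl_pi x) (psl_pi y) = psl_pi (slbracket x y).
Proof.
have /eqP/psl_piP[c hc] : psl_pi (repr (psl_pi x)) = psl_pi x by apply: reprK.
have /eqP/psl_piP[d hd] : psl_pi (repr (psl_pi y)) = psl_pi y by apply: reprK.
apply/eqP/psl_piP; exists 0; rewrite raddf0 /=.
move/eqP: hc; rewrite subr_eq => /eqP ->.
move/eqP: hd; rewrite subr_eq => /eqP ->.
by rewrite sbracketDl sbracket_scalarl sbracketDr sbracket_scalarr !add0r subrr.
Qed.

Local Open Scope classical_set_scope.

Definition psl_part (a : bool) : set psl := [set psl_pi x | x in sl_hom a].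

Definition psl_centralizer (e : psl) : set psl :=
  [set x | psl_bracket e x = 0].

Definition psl_center (h : set psl) : set psl :=
  [set z | h z /\ forall x, h x -> psl_bracket z x = 0].

Lemma block_diag_exp (m : nat) (a : 'M[F]_m) (d : 'M[F]_n) k :
  block_mx a 0 0 d ^+ k = block_mx (a ^+ k) 0 0 (d ^+ k).
Proof.
elim: k => [|k IHk]; first by rewrite !expr0 -scalar_mx_block.
rewrite !exprS IHk [LHS]mulmx_block.
by rewrite !(mul0mx, mulmx0, add0r, addr0).
Qed.

Lemma sl_pow_subproof (u : sl) (k : nat) :
  sl_hom false u -> (exists l, (val u) ^+ l = 0) -> (0 < k)%N ->
  (val u) ^+ k \in sl_pred.
Proof.
rewrite /sl_hom /= => <- [l]; rewrite block_diag_exp => ul0 k0.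
rewrite unfold_in /hpart block_diag_exp /supertrace block_mxKul block_mxKdr.
have := congr1 ulsubmx ul0; have := congr1 drsubmx ul0.
rewrite block_mxKul block_mxKdr /drsubmx /ulsubmx !linear0 => d0 a0.
by rewrite !(mxtrace_nilpotent_exp k0) ?subrr //; exists l.
Qed.

Definition nilpotent_lift (u : sl) (e : psl) : Prop :=
  [/\ sl_hom false u, exists k : nat, (val u) ^+ k = 0 & psl_pi u = e].

(* The image of the matrix power u^k, which lies in sl(n|n) by sl_pow_subproof;
   the default value of insubd can only arise
   for k = 0 or u not even nilpotent. *)
Definition psl_pow (u : sl) (k : nat) : psl :=
  psl_pi (insubd 0 ((val u) ^+ k)).

Lemma psl_pow_subproof (u x : sl) (k : nat) :
  val x = (val u) ^+ k -> psl_pow u k = psl_pi x.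
Proof. by rewrite /psl_pow => <-; rewrite valKd. Qed.

End SpecialLinear.

Definition lspan (F : fieldType) (V : lmodType F) (s : seq V) : set V :=
  [set z | exists c : 'I_(size s) -> F, z = \sum_i c i *: s`_i]%classic.

Section JordanType.
Variable F : fieldType.

Definition nilp_jordan_block (k : nat) : 'M[F]_k :=
  \matrix_(i, j) (j == i.+1 :> nat)%:R.

Definition nilp_jordan_mx (p : seq nat) : 'M[F]_(\sum_(i < size p) nth 0%N p i) :=
  \mxdiag_(i < size p) nilp_jordan_block (nth 0%N p i).

(* The columns of P form a Jordan basis of F^n for A. *)
Definition nilp_jordan_sizes (n : nat) (A : 'M[F]_n) (p : seq nat) : Prop :=
  all (leq 1) p /\
  exists P : 'M[F]_(n, \sum_(i < size p) nth 0%N p i),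
    [/\ row_free P, row_full P & A *m P = P *m nilp_jordan_mx p].

Definition jordan_type (n : nat) (u : sl F n) (lam : seq nat) : Prop :=
  exists p q : seq nat,
    [/\ nilp_jordan_sizes (ulsubmx (val u)) p,
        nilp_jordan_sizes (drsubmx (val u)) q
      & lam = sort geq (p ++ q)].

End JordanType.

Definition is_partition (n : nat) (p : seq nat) : Prop :=
  [/\ sorted geq p, all (leq 1) p & sumn p = n].

Definition is_super_partition (m n : nat) (lam : seq nat) : Prop :=
  exists p q : seq nat,
    [/\ is_partition m p, is_partition n q & lam = sort geq (p ++ q)].

(* Main.v *)
Require Import Defs.
From mathcomp Require Import all_boot all_order all_algebra.
From mathcomp Require Import boolp classical_sets reals complex.

(**
Write C for the algebra of the matrices commuting with u.  A scalar commutator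
c has zero trace 2n c, hence is zero, so the centralizer of e consists of the
images of the x in C of supertrace zero (psl_centralizerP).  An element of the
centre is then the image of a z in C whose superbrackets with all these x are
scalar, and each parity component z0, z1 of z can be treated separately.

The even part commutes with every x as above: for even x a scalar commutator
is zero by the trace, and for odd x the commutator [z0, x] is odd
and equals the odd part of a scalar, which is zero.
The parity operator diag(1, -1) commutes with z0 and u and has supertrace
2n, so z0 commutes with all of C (even_part_central).  Hence z0 is a
polynomial in u by the double centralizer theorem.  For nilpotent u
that theorem has a short direct proof: if u^(d+1) = 0, every matrix w gives an
element sum_k u^k w u^(d-k) of C (intertwiner_sumP).  Testing z0 against those
with w elementary gives an identity z0 g(u) = f(u), where g has constant
coefficient an entry of u^d; chosen nonzero, it makes g(u) a unit.

The odd part vanishes (odd_part_eq0).  Let a and b be the diagonal blocks of u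
and A the lower left block of z1, the other one being alike.  Both diag(a, 0)
and diag(0, b) have supertrace zero, so commuting with them gives A a = 0 and b A = 0.  For an
intertwiner x with a x = x b, the anticommutator condition says that x A and
A x are the same scalar.  If x is one of the sums above with w elementary, all
terms but one die, and x A = a^d w A, A x = A w b^d have rank at most one.
A scalar matrix of size n > 1 and rank at most one is zero, which forces
A = 0 because a^d or b^d is nonzero for the right d.

Modulo scalars, polynomials in u are spanned by u, ..., u^(N-1) as soon as
u^N = 0, and the Jordan normal form gives this for N the largest block size.
*)

Set Implicit Arguments.
Unset Strict Implicit.
Unset Printing Implicit Defensive.
Import GRing.Theory.
Local Open Scope ring_scope.

(** * Intertwiners of nilpotent matrices *)

Section Intertwiners.
Variable F : fieldType.

(** Powers are defined by the ring product of square matrices, which is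
    convertible to the rectangular product but not syntactically equal to it;
    this and the next lemma unfold powers with the latter. *)
Lemma mx_exprS n (a : 'M[F]_n) k : a ^+ k.+1 = a *m a ^+ k.
Proof. exact: exprS. Qed.

Lemma mx_exprSr n (a : 'M[F]_n) k : a ^+ k.+1 = a ^+ k *m a.
Proof. exact: exprSr. Qed.

(** The divided difference (a^(d+1) - b^(d+1)) / (a - b) applied to w, where a acts
    by left and b by right multiplication. *)
Definition intertwiner_sum (m n : nat) (a : 'M[F]_m) (b : 'M[F]_n) d
    (w : 'M[F]_(m, n)) : 'M[F]_(m, n) :=
  \sum_(k < d.+1) a ^+ k *m w *m b ^+ (d - k).

(** The difference of the two sides telescopes to a^(d+1) w - w b^(d+1). *)
Lemma intertwiner_sumP (m n : nat) (a : 'M[F]_m) (b : 'M[F]_n) d w :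
  a ^+ d.+1 = 0 -> b ^+ d.+1 = 0 ->
  a *m intertwiner_sum a b d w = intertwiner_sum a b d w *m b.
Proof.
move=> a0 b0; rewrite /intertwiner_sum mulmx_sumr mulmx_suml.
rewrite big_ord_recr big_ord_recl /= subnn expr0 mulmx1 subn0.
rewrite !mulmxA -mx_exprS a0 mul0mx addr0 expr0 mul1mx.
rewrite -[w *m _ *m b]mulmxA -mx_exprSr b0 mulmx0 add0r.
apply: eq_bigr => k _; rewrite !mulmxA -mx_exprS -[RHS]mulmxA -mx_exprSr.
by rewrite /bump /= add1n subnSK.
Qed.

Lemma mulmx_delta_mulmxE (m n p q : nat) (a : 'M[F]_(m, n)) (b : 'M[F]_(p, q))
    i j s t :
  (a *m delta_mx i j *m b) s t = a s i * b j t.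
Proof.
rewrite !mxE (bigD1 j) //= big1 => [|k kj].
  rewrite addr0 !mxE (bigD1 i) //= big1 => [|l li].
    by rewrite !mxE !eqxx mulr1 addr0.
  by rewrite !mxE (negbTE li) mulr0.
by rewrite !mxE big1 ?mul0r // => l _; rewrite !mxE (negbTE kj) andbF mulr0.
Qed.

End Intertwiners.

(** * The double centralizer of a nilpotent matrix *)

Section DoubleCentralizer.
Variables (F : fieldType) (m : nat) (u : 'M[F]_m.+1) (d : nat).
Hypotheses (ud_neq0 : u ^+ d != 0) (udS0 : u ^+ d.+1 = 0).

(** A polynomial with nonzero constant term is prime to a power of X, and the
    Bezout relation provides the inverse. *)
Lemma horner_mx_nilpotent_unit (g : {poly F}) :
  g`_0 != 0 -> exists h, horner_mx u g * horner_mx u h = 1.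
Proof.
move=> g0; have : coprimep g ('X ^+ d.+1).
  by rewrite coprimep_expr // coprimepX rootE horner_coef0.
move=> /Bezout_eq1_coprimepP [[a b] /= ab]; exists a.
rewrite -rmorphM mulrC /=; have := congr1 (horner_mx u) ab.
by rewrite rmorphD rmorph1 !rmorphM rmorphXn /= horner_mx_X udS0 mulr0 addr0.
Qed.

Lemma horner_mx_poly n (c : nat -> F) :
  horner_mx u (\poly_(k < n) c k) = \sum_(k < n) c k *: u ^+ k.
Proof.
rewrite poly_def rmorph_sum; apply: eq_bigr => k _.
by rewrite /= linearZ /= rmorphXn /= horner_mx_X.
Qed.

(** Commuting with the sums built on an elementary matrix w = E_(t, i0) and
    reading off column j0 gives z g(u) = f(u), one column t at a time; the entry
    (u^d)_(i0, j0) is the constant term of g. *)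
Lemma double_centralizer_nilpotent (z : 'M[F]_m.+1) :
  (forall x, u *m x = x *m u -> z *m x = x *m z) ->
  exists p, z = horner_mx u p.
Proof.
move=> zC.
have /matrix0Pn[i0 [j0 dij]] := ud_neq0.
pose g := \poly_(k < d.+1) (u ^+ (d - k)) i0 j0.
pose f := \poly_(k < d.+1) (u ^+ (d - k) *m z) i0 j0.
have zg : z * horner_mx u g = horner_mx u f.
  rewrite !horner_mx_poly; apply/matrixP => s t.
  have := zC _ (intertwiner_sumP (delta_mx t i0) udS0 udS0).
  move=> /matrixP/(_ s j0); rewrite /intertwiner_sum mulmx_sumr mulmx_suml.
  rewrite -mulmxE mulmx_sumr !summxE => E; transitivity
    (\sum_(k < d.+1) (z *m (u ^+ k *m delta_mx t i0 *m u ^+ (d - k))) s j0).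
    apply: eq_bigr => k _.
    by rewrite !mulmxA mulmx_delta_mulmxE -scalemxAr mxE mulrC.
  rewrite E; apply: eq_bigr => k _.
  by rewrite -mulmxA mulmx_delta_mulmxE [RHS]mxE mulrC.
have [|h gh] := @horner_mx_nilpotent_unit g; first by rewrite coef_poly /= subn0.
by exists (f * h); rewrite rmorphM /= -zg -mulrA gh mulr1.
Qed.

End DoubleCentralizer.

(** N need not be the nilpotency index: the powers beyond it vanish. *)
Lemma nilpotent_powers_double_centralizer (F : fieldType) m (u z : 'M[F]_m) N :
  (0 < m)%N -> u ^+ N = 0 -> (forall x, u *m x = x *m u -> z *m x = x *m z) ->
  exists c : nat -> F, z = \sum_(k < N) c k *: u ^+ k.
Proof.
case: m u z => // m u z _ uN zC.
have uex : exists k, u ^+ k == 0 by exists N; apply/eqP.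
case: (ex_minnP uex) => -[|d] /eqP ud dmin.
  by move/eqP: ud; rewrite expr0 oner_eq0.
have ud0 : u ^+ d != 0 by apply/negP => /dmin; rewrite ltnn.
have [p ->] := double_centralizer_nilpotent ud0 ud zC.
exists (fun k => (p %% 'X^N)`_k); rewrite -horner_mx_poly.
rewrite {1}(divp_eq p 'X^N) rmorphD rmorphM rmorphXn /= horner_mx_X uN mulr0 add0r.
congr horner_mx; apply/polyP => k; rewrite coef_poly; case: ltnP => // Nk.
apply/nth_default/(leq_trans _ Nk); rewrite -ltnS -(@size_polyXn F N).
by rewrite ltn_modp monic_neq0 ?monicXn.
Qed.

(** * Intertwiners with scalar products *)

Section ScalarProducts.
Variables (F : fieldType) (n : nat).

(** The hypothesis says that the outer product of v and w is a scalar matrix;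
    two distinct indices s, t give c^2 = (v_s w_t) (v_t w_s) = 0. *)
Lemma rank1_scalar_eq0 (v w : 'I_n -> F) (c : F) : (1 < n)%N ->
  (forall s t, v s * w t = c *+ (s == t)) -> forall s t, v s * w t = 0.
Proof.
move=> n1 H; suff c0: c = 0 by move=> s t; rewrite H c0 mul0rn.
pose s : 'I_n := Ordinal (ltnW n1); pose t : 'I_n := Ordinal n1.
have := H s t; have := H s s; have := H t t; rewrite !eqxx /= !mulr1n mulr0n.
move=> tt <- /eqP; rewrite mulf_eq0 => /orP [/eqP->|/eqP w0]; first by rewrite mul0r.
by rewrite (H s s) eqxx mulr1n -tt w0 mulr0.
Qed.

(** A a = 0 and b A = 0 leave a single term of x A and of A x when x is an
    intertwiner sum: a^d w A and A w b^d respectively.  For w elementary these are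
    outer products, hence vanish, which contradicts A != 0 through the first
    one if a^d != 0 and through the second one if b^d != 0. *)
Lemma odd_block_eq0 (a b A : 'M[F]_n) d : (1 < n)%N ->
  a ^+ d.+1 = 0 -> b ^+ d.+1 = 0 -> a ^+ d != 0 \/ b ^+ d != 0 ->
  A *m a = 0 -> b *m A = 0 ->
  (forall x, a *m x = x *m b ->
     exists c : F, x *m A = c%:M /\ A *m x = c%:M) ->
  A = 0.
Proof.
move=> n1 a0 b0 ab Aa bA H; apply/matrixP => s t; rewrite mxE.
apply/eqP/negPn/negP => Ast.
have xA i j : intertwiner_sum a b d (delta_mx i j) *m A =
    a ^+ d *m delta_mx i j *m A.
  rewrite mulmx_suml big_ord_recr /= subnn mulmx1 big1 ?add0r // => k _.
  by rewrite -(subnSK (ltn_ord k)) mx_exprSr -!mulmxA bA !mulmx0.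
have Ax i j : A *m intertwiner_sum a b d (delta_mx i j) =
    A *m delta_mx i j *m b ^+ d.
  rewrite mulmx_sumr big_ord_recl /= subn0 mul1mx big1 ?addr0 ?mulmxA // => k _.
  by rewrite !mulmxA mx_exprS !mulmxA Aa !mul0mx.
case: ab => /eqP; apply; apply/matrixP => i j; rewrite [RHS]mxE.
  have [c [cE _]] := H _ (intertwiner_sumP (delta_mx j s) a0 b0).
  have := @rank1_scalar_eq0 (fun k => (a ^+ d) k j) (fun k => A s k) c n1.
  move=> /(_ _ i t) /= K; apply/eqP; have /eqP : (a ^+ d) i j * A s t = 0.
    by apply: K => k l; rewrite -mulmx_delta_mulmxE -xA cE mxE.
  by rewrite mulf_eq0 (negbTE Ast) orbF.
have [c [_ cE]] := H _ (intertwiner_sumP (delta_mx t i) a0 b0).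
have := @rank1_scalar_eq0 (fun k => A k t) (fun k => (b ^+ d) i k) c n1.
move=> /(_ _ s j) /= K; apply/eqP; have /eqP : A s t * (b ^+ d) i j = 0.
  by apply: K => k l; rewrite -mulmx_delta_mulmxE -Ax cE mxE.
by rewrite mulf_eq0 (negbTE Ast).
Qed.

End ScalarProducts.

(** * Super commutators *)

(* With a constructor as parity, simplification would unfold hpart and hide it
   from the rewriting lemmas below. *)
Local Arguments hpart : simpl never.

Section Super.
Variables (F : fieldType) (m n : nat).
Implicit Types x y z : 'M[F]_(m + n).

Lemma hpart_block a (A : 'M[F]_m) B C (D : 'M[F]_n) :
  hpart a (block_mx A B C D) = if a then block_mx 0 B C 0 else block_mx A 0 0 D.
Proof. by rewrite /hpart block_mxKul block_mxKur block_mxKdl block_mxKdr. Qed.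

Lemma hpart_hpart a b x : hpart a (hpart b x) = if a == b then hpart b x else 0.
Proof.
rewrite -(submxK x) !hpart_block.
by case: a b => -[] /=; rewrite !hpart_block // block_mx0.
Qed.

Lemma hpart_id a x : hpart a (hpart a x) = hpart a x.
Proof. by rewrite hpart_hpart eqxx. Qed.

Lemma hpart_mull a b x y :
  hpart b y = y -> hpart a (y *m x) = y *m hpart (a (+) b) x.
Proof.
move=> <-; rewrite -(submxK x) -(submxK y) !hpart_block.
case: a b => -[] /=.
all: by rewrite !mulmx_block !(mulmx0, mul0mx, addr0, add0r) hpart_block.
Qed.

Lemma hpart_mulr a b x y :
  hpart b y = y -> hpart a (x *m y) = hpart (a (+) b) x *m y.
Proof.
move=> <-; rewrite -(submxK x) -(submxK y) !hpart_block.
case: a b => -[] /=.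
all: by rewrite !mulmx_block !(mulmx0, mul0mx, addr0, add0r) hpart_block.
Qed.

Lemma sbracket_homog a b x y : hpart a x = x -> hpart b y = y ->
  sbracket x y = x *m y - (-1) ^+ (a && b) *: (y *m x).
Proof.
move=> <- <-; rewrite /sbracket !big_bool /= !hpart_hpart.
by case: a b => -[] /=; rewrite !(mulmx0, mul0mx, scaler0, oppr0, addr0, add0r).
Qed.

Lemma sbracket_evenl x y : hpart false x = x -> sbracket x y = x *m y - y *m x.
Proof.
move=> x0; rewrite -(hpartD y) sbracketDr.
rewrite !(sbracket_homog x0 (hpart_id _ _)) /= expr0.
by rewrite !scale1r mulmxDr mulmxDl addrACA opprD.
Qed.

Lemma sbracket_evenr x y : hpart false y = y -> sbracket x y = x *m y - y *m x.
Proof.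
move=> y0; rewrite -(hpartD x) sbracketDl.
rewrite !(sbracket_homog (hpart_id _ _) y0) /= !expr0.
by rewrite !scale1r mulmxDr mulmxDl addrACA opprD.
Qed.

Lemma hpart_commute a u x : hpart false u = u ->
  u *m x = x *m u -> u *m hpart a x = hpart a x *m u.
Proof.
move=> u0 ux; rewrite -[in LHS](addbF a) -hpart_mull // ux.
by rewrite (hpart_mulr _ _ u0) addbF.
Qed.

Lemma supertrace_odd x : hpart true x = x -> supertrace x = 0.
Proof.
by move=> <-; rewrite /supertrace /hpart block_mxKul block_mxKdr !mxtrace0 subrr.
Qed.

(** An even matrix in the centre of the even part, of nonzero supertrace: it
    complements the matrices of supertrace zero. *)
Definition parity_mx : 'M[F]_(m + n) := block_mx 1%:M 0 0 (- 1%:M).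

Lemma parity_mx_even : hpart false parity_mx = parity_mx.
Proof. by rewrite hpart_block. Qed.

Lemma parity_mx_commute x : hpart false x = x -> parity_mx *m x = x *m parity_mx.
Proof.
move=> <-; rewrite /parity_mx /hpart !mulmx_block.
rewrite !(mulmx0, mul0mx, addr0, add0r, mul1mx, mulmx1).
by rewrite mulmxN mulNmx mulmx1 mul1mx.
Qed.

Lemma supertrace_parity_mx : supertrace parity_mx = (m + n)%:R.
Proof.
by rewrite /supertrace block_mxKul block_mxKdr linearN /= !mxtrace1 opprK natrD.
Qed.

Lemma commutator_scalar_eq0 x y (c : F) : (m + n)%:R != 0 :> F ->
  x *m y - y *m x = c%:M -> c = 0.
Proof.
move=> ch /(congr1 mxtrace); rewrite linearB /= mxtrace_mulC subrr mxtrace_scalar.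
by move/esym/eqP; rewrite -mulr_natr mulf_eq0 (negbTE ch) orbF => /eqP.
Qed.

(** The lift to sl(m|n) of being central in a centralizer of the quotient by the
    scalars. *)
Definition sl_central_mod_scalars u z :=
  forall x, supertrace x = 0 -> u *m x = x *m u ->
    exists c : F, sbracket z x = c%:M.

Variables (u z : 'M[F]_(m + n)).
Hypotheses (char_mn : (m + n)%:R != 0 :> F) (u_even : hpart false u = u).
Hypothesis z_central : sl_central_mod_scalars u z.

(** The bracket with an even x is a commutator, so the scalar is zero. *)
Lemma central_even_sl x : hpart false x = x -> supertrace x = 0 ->
  u *m x = x *m u -> z *m x = x *m z.
Proof.
move=> x0 xs ux; have [c cE] := z_central xs ux.
rewrite sbracket_evenr // in cE; have c0 := commutator_scalar_eq0 char_mn cE.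
by move/eqP: cE; rewrite c0 raddf0 subr_eq0 => /eqP.
Qed.

(** Split the scalar bracket with an odd x by parity: scalars are even. *)
Lemma central_odd x : hpart true x = x -> u *m x = x *m u ->
  hpart false z *m x = x *m hpart false z /\
  exists c : F, hpart true z *m x + x *m hpart true z = c%:M.
Proof.
move=> x1 ux; have [c cE] := z_central (supertrace_odd x1) ux.
have [zp zq] : hpart false (hpart false z) = hpart false z /\
  hpart true (hpart true z) = hpart true z by rewrite !hpart_hpart.
rewrite -(hpartD z) sbracketDl (sbracket_homog zp x1) (sbracket_homog zq x1) /= in cE.
rewrite expr0 expr1 scale1r scaleN1r opprK in cE.
split.
  apply/eqP; rewrite -subr_eq0; apply/eqP.
  have := congr1 (hpart true) cE; rewrite hpart_scalar !linearD linearN /=.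
  rewrite !(hpart_mulr true _ x1) !(hpart_mull true _ x1) /= !hpart_hpart /=.
  by rewrite !(mulmx0, mul0mx) !addr0.
exists c; have := congr1 (hpart false) cE; rewrite hpart_scalar !linearD linearN /=.
rewrite !(hpart_mulr false _ x1) !(hpart_mull false _ x1) /= !hpart_hpart /=.
by rewrite !(mulmx0, mul0mx) subrr add0r.
Qed.

(** Subtracting a multiple of the parity matrix gives an even x supertrace zero,
    and odd matrices always have supertrace zero. *)
Lemma even_part_central x : u *m x = x *m u ->
  hpart false z *m x = x *m hpart false z.
Proof.
move=> ux; rewrite -(hpartD x) mulmxDl mulmxDr; congr (_ + _); last first.
  by apply: (central_odd _ _).1; rewrite ?hpart_hpart //; exact: hpart_commute.
move: (hpart false x) (hpart_id false x) (hpart_commute false u_even ux).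
move=> {}x x0 {}ux.
pose t := supertrace x / (m + n)%:R; pose y := x - t *: parity_mx.
have zy : z *m y = y *m z.
  apply: central_even_sl.
  - by rewrite linearB linearZ /= x0 parity_mx_even.
  - by rewrite linearB linearZ /= supertrace_parity_mx divfK // subrr.
  - by rewrite mulmxBr mulmxBl ux -scalemxAr -scalemxAl parity_mx_commute.
have y0 : hpart false y = y by rewrite linearB linearZ /= x0 parity_mx_even.
have -> : x = y + t *: parity_mx by rewrite subrK.
rewrite mulmxDr mulmxDl -scalemxAr -scalemxAl parity_mx_commute ?hpart_hpart //.
congr (_ + _); have := congr1 (hpart false) zy.
by rewrite (hpart_mulr _ _ y0) (hpart_mull _ _ y0).
Qed.

End Super.

(** The blocks of z1 are treated alike: diag(a, 0) and diag(0, b) have supertrace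
    zero since a and b are nilpotent, which kills A a, b A, a B and B b, and the odd
    matrices with one nonzero block test the two anticommutator blocks. *)
Lemma odd_part_eq0 (F : fieldType) (n N : nat) (u z : 'M[F]_(n + n)) :
  (1 < n)%N -> (n + n)%:R != 0 :> F -> hpart false u = u -> u ^+ N = 0 ->
  sl_central_mod_scalars u z -> hpart true z = 0.
Proof.
move=> n1 ch u0 uN zC.
have comm_sl x : hpart false x = x -> supertrace x = 0 ->
    u *m x = x *m u -> hpart true z *m x = x *m hpart true z.
  move=> x0 xs ux; have := congr1 (hpart true) (central_even_sl ch zC x0 xs ux).
  by rewrite (hpart_mulr _ _ x0) (hpart_mull _ _ x0).
have comm_odd x x1 ux := (@central_odd _ _ _ u z zC x x1 ux).2.
move: comm_sl comm_odd; pose A := dlsubmx z; pose B := ursubmx z.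
rewrite -[hpart true z]/(block_mx 0 B A 0).
pose a := ulsubmx u; pose b := drsubmx u.
have uE : u = block_mx a 0 0 b by rewrite -u0.
(* d + 1 is the larger of the two nilpotency indices, so that both powers vanish
   at d + 1 but not both at d. *)
have ex0 : exists k, (a ^+ k == 0) && (b ^+ k == 0).
  exists N; move: uN; rewrite uE block_diag_exp -(@block_mx0 F n n n n).
  by move/eq_block_mx => [-> _ _ ->]; rewrite eqxx.
case: (ex_minnP ex0) => -[|d].
  rewrite expr0 => /andP[/eqP/matrixP/(_ (Ordinal n1) (Ordinal n1))].
  by rewrite !mxE eqxx => /eqP; rewrite oner_eq0.
move=> /andP[/eqP ad /eqP bd] dmin.
have ab : a ^+ d != 0 \/ b ^+ d != 0.
  by apply/orP; rewrite -negb_and; apply/negP => /dmin; rewrite ltnn.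
have tra : \tr a = 0 by apply: mxtrace_nilpotent; exists d.+1.
have trb : \tr b = 0 by apply: mxtrace_nilpotent; exists d.+1.
rewrite uE => comm_sl comm_odd.
have := comm_sl (block_mx a 0 0 0).
have := comm_sl (block_mx 0 0 0 b).
rewrite /supertrace !block_mxKul !block_mxKdr !hpart_block tra trb mxtrace0 subrr.
rewrite !mulmx_block !(mulmx0, mul0mx, addr0, add0r).
move=> /(_ erefl erefl erefl)/eq_block_mx[_ Bb bA _].
move=> /(_ erefl erefl erefl)/eq_block_mx[_ aB Aa _].
have A0 : A = 0.
  apply: (odd_block_eq0 n1 ad bd ab) => // x ax.
  have [||c] := comm_odd (block_mx 0 x 0 0); first by rewrite hpart_block.
    by rewrite !mulmx_block !(mulmx0, mul0mx, addr0, add0r) ax.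
  rewrite !mulmx_block add_block_mx !(mulmx0, mul0mx, addr0, add0r).
  by rewrite scalar_mx_block => /eq_block_mx[xA _ _ Ax]; exists c.
have B0 : B = 0.
  apply: (odd_block_eq0 n1 bd ad) => // [|x bx]; first by case: ab; [right|left].
  have [||c] := comm_odd (block_mx 0 0 x 0); first by rewrite hpart_block.
    by rewrite !mulmx_block !(mulmx0, mul0mx, addr0, add0r) bx.
  rewrite !mulmx_block add_block_mx !(mulmx0, mul0mx, addr0, add0r).
  by rewrite scalar_mx_block => /eq_block_mx[Bx _ _ xB]; exists c.
by rewrite A0 B0 block_mx0.
Qed.

(** * The centre of a centralizer in psl(n|n) *)

Section Psl.
Variables (F : fieldType) (n : nat).

Lemma psl_piZ c (x : sl F n) : psl_pi (c *: x) = c *: psl_pi x.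
Proof. by rewrite -psl_pi_scale. Qed.

Lemma psl_pi_eq0 (x : sl F n) : psl_pi x = 0 <-> exists c : F, val x = c%:M.
Proof.
rewrite -(raddf0 (@psl_pi F n)); split=> [/eqP/psl_piP|] [c cE].
  by exists c; rewrite -cE (raddf0 val) subr0.
by apply/eqP/psl_piP; exists c; rewrite (raddf0 val) subr0.
Qed.

(** A commutator that is a scalar is zero, so the quotient by the scalars does not
    enlarge the centralizer. *)
Lemma psl_centralizerP (u x : sl F n) : (n + n)%:R != 0 :> F ->
  sl_hom false u ->
  psl_centralizer (psl_pi u) (psl_pi x) <-> val u *m val x = val x *m val u.
Proof.
move=> ch u0; rewrite /psl_centralizer /= psl_pi_bracket psl_pi_eq0 /=.
rewrite sbracket_evenl //; split=> [[c cE]|->].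
  by apply/eqP; rewrite -subr_eq0 cE (commutator_scalar_eq0 ch cE) raddf0.
by exists 0; rewrite subrr raddf0.
Qed.

Lemma psl_centerP (u z : sl F n) : (n + n)%:R != 0 :> F ->
  sl_hom false u ->
  psl_center (psl_centralizer (psl_pi u)) (psl_pi z) <->
  val u *m val z = val z *m val u /\ sl_central_mod_scalars (val u) (val z).
Proof.
move=> ch u0; rewrite /psl_center /= psl_centralizerP //.
split=> -[uz zC]; split=> // x.
  move=> /eqP xs ux; have := zC (psl_pi (Sl (xs : x \in @sl_pred F n))).
  rewrite psl_centralizerP // => /(_ ux).
  by rewrite psl_pi_bracket => /psl_pi_eq0.
have [{}x <-] := psl_pi_surj x; rewrite psl_centralizerP // => ux.
rewrite psl_pi_bracket; apply/psl_pi_eq0/zC => //.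
by apply/eqP; exact: sl_mxP.
Qed.

End Psl.

(** Coefficients indexed by nat spare a transport along the equation size s = m. *)
Lemma lspanP (F : fieldType) (V : lmodType F) (s : seq V) m (g : nat -> V) z :
  size s = m -> (forall i, (i < m)%N -> s`_i = g i) ->
  lspan s z <-> exists c : nat -> F, z = \sum_(i < m) c i *: g i.
Proof.
move=> <- sg; split=> -[c ->].
  exists (fun i => if insub i is Some j then c j else 0).
  by apply: eq_bigr => i _; rewrite sg // valK.
by exists (fun i => c i); apply: eq_bigr => i _; rewrite sg.
Qed.

(** A central element lifts, modulo scalars, to a polynomial in u because its odd
    part vanishes and its even part is in the double centralizer of u.
    Conversely, a polynomial in u is even, so its brackets are commutators, and
    these vanish on the matrices commuting with u. *)
Lemma psl_center_nilpotent (F : fieldType) (n N : nat) (u : sl F n) :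
  (1 < n)%N -> (n + n)%:R != 0 :> F -> sl_hom false u -> val u ^+ N = 0 ->
  psl_center (psl_centralizer (psl_pi u)) =
  lspan [seq psl_pow u k | k <- iota 1 N.-1].
Proof.
move=> n1 ch u0 uN; have n0 : (0 < n + n)%N by rewrite addn_gt0 (ltnW n1).
case: N uN => [|N] uN.
  have /matrixP/(_ (Ordinal n0) (Ordinal n0)) := uN.
  by rewrite !mxE eqxx => /eqP; rewrite oner_eq0.
have u_pow k : val (insubd (0 : sl F n) (val u ^+ k.+1)) = val u ^+ k.+1.
  by apply: insubdK; apply: sl_pow_subproof => //; exists N.+1.
pose lift (c : nat -> F) : sl F n := \sum_(i < N) c i *: insubd 0 (val u ^+ i.+1).
have liftE c : psl_pi (lift c) = \sum_(i < N) c i *: psl_pow u i.+1.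
  by rewrite raddf_sum; apply: eq_bigr => i _; rewrite /= psl_piZ.
have val_liftE c : val (lift c) = \sum_(i < N) c i *: val u ^+ i.+1.
  by rewrite linear_sum; apply: eq_bigr => i _; rewrite linearZ /= u_pow.
have spanP z : lspan [seq psl_pow u k | k <- iota 1 N] z <->
    exists c : nat -> F, z = psl_pi (lift c).
  rewrite (@lspanP _ _ _ N (fun i => psl_pow u i.+1)).
  - by split=> -[c ->]; exists c; rewrite liftE.
  - by rewrite size_map size_iota.
  - by move=> i iN; rewrite (nth_map 0%N) ?size_iota // nth_iota.
apply/funext => z; apply/propext; rewrite spanP; split=> [|[c ->]].
  have [{}z <-] := psl_pi_surj z => /(psl_centerP z ch u0)[uz zC].
  have zE : hpart false (val z) = val z.
    by rewrite -[RHS]hpartD (odd_part_eq0 n1 ch u0 uN zC) addr0.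
  have [|c cE] := nilpotent_powers_double_centralizer n0 uN (z := val z).
    by move=> x ux; rewrite -zE; apply: (even_part_central ch u0 zC).
  (* The constant term of the polynomial is the scalar lost in the quotient. *)
  exists (fun i => c i.+1); apply/eqP/psl_piP; exists (c 0%N).
  by rewrite cE val_liftE big_ord_recl /= expr0 addrK scalemx1.
have liftC x : val u *m x = x *m val u -> val (lift c) *m x = x *m val (lift c).
  move=> ux; rewrite val_liftE mulmx_suml mulmx_sumr; apply: eq_bigr => i _.
  rewrite -scalemxAl -scalemxAr; congr (_ *: _).
  elim: (nat_of_ord i).+1 => [|k IH]; first by rewrite expr0 mul1mx mulmx1.
  by rewrite mx_exprS -mulmxA IH !mulmxA ux.
have lift_even : hpart false (val (lift c)) = val (lift c).
  rewrite val_liftE raddf_sum; apply: eq_bigr => i _; rewrite /= linearZ /=.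
  congr (_ *: _); elim: (nat_of_ord i).+1 => [|k IH].
    by rewrite expr0 hpart_scalar.
  by rewrite mx_exprS (hpart_mull _ _ u0) IH.
apply/(psl_centerP _ ch u0); split=> [|x xs ux]; first by rewrite liftC.
by exists 0; rewrite sbracket_evenl // liftC // subrr raddf0.
Qed.

(** * Nilpotency from the Jordan type *)

Section Jordan.
Variable F : fieldType.

Lemma nilp_jordan_block_exp k m :
  nilp_jordan_block F k ^+ m = \matrix_(i, j) (j == i + m :> nat)%N%:R.
Proof.
elim: m => [|m IH]; apply/matrixP => i j.
  by rewrite expr0 !mxE addn0 eq_sym.
rewrite mx_exprSr IH !mxE.
under eq_bigr do rewrite !mxE -natrM mulnb.
case: (ltnP (i + m) k) => im.
  rewrite (bigD1 (Ordinal im)) //= eqxx /= big1 ?addr0 ?addnS // => l lm.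
  by rewrite -(inj_eq val_inj) /= in lm; rewrite (negbTE lm).
rewrite big1 => [|l _]; last by rewrite ltn_eqF //=; exact: leq_trans im.
by rewrite ltn_eqF // addnS; exact: leq_trans (leqW im).
Qed.

Lemma nilp_jordan_block_nilpotent k m :
  (k <= m)%N -> nilp_jordan_block F k ^+ m = 0.
Proof.
move=> km; rewrite nilp_jordan_block_exp; apply/matrixP => i j; rewrite !mxE.
by rewrite ltn_eqF // (leq_trans (ltn_ord j)) // (leq_trans km) ?leq_addl.
Qed.

Lemma nilp_jordan_mx_exp p m :
  nilp_jordan_mx F p ^+ m =
  \mxdiag_(i < size p) nilp_jordan_block F (nth 0%N p i) ^+ m.
Proof.
elim: m => [|m IH].
  rewrite expr0; under eq_mxdiag do rewrite expr0.
  by rewrite mxdiagZ.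
rewrite mx_exprS IH /nilp_jordan_mx [X in _ *m X]/mxdiag mul_mxdiag_mxblock.
rewrite /mxdiag; apply/eq_mxblock => i j; case: eqVneq => [->|_].
  by rewrite !conform_mx_id mx_exprS.
by rewrite mulmx0.
Qed.

(** A P = P J gives A^N P = P J^N, and P has independent rows. *)
Lemma nilp_jordan_sizes_nilpotent n (A : 'M[F]_n) p N :
  nilp_jordan_sizes A p -> all (geq N) p -> A ^+ N = 0.
Proof.
move=> [_ [P [Pf _ AP]]] /allP pN; apply: (row_free_inj Pf); rewrite /= mul0mx.
have -> : A ^+ N *m P = P *m nilp_jordan_mx F p ^+ N.
  elim: N {pN} => [|N IH]; first by rewrite !expr0 mul1mx mulmx1.
  by rewrite !mx_exprSr -mulmxA AP mulmxA IH -mulmxA.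
rewrite nilp_jordan_mx_exp; under eq_mxdiag => i.
  rewrite nilp_jordan_block_nilpotent; last exact/pN/mem_nth.
over.
by rewrite mxdiag0 mulmx0.
Qed.

End Jordan.

Lemma all_geq_head_sort s : all (geq (head 0%N (sort geq s))) s.
Proof.
have geq_total : total geq by move=> x y; exact: leq_total.
have geq_trans : transitive geq by move=> y x z /= xy yz; exact: leq_trans yz xy.
have := sort_sorted geq_total s; rewrite -(perm_all _ (permEl (perm_sort geq s))).
by case: (sort geq s) => //= x r /(order_path_min geq_trans) ->; rewrite leqnn.
Qed.

Theorem theorem9 (R : realType) (n : nat) (n_gt1 : (1 < n)%N)
    (lam : seq nat) (lam_part : is_super_partition n n lam)
    (e : psl R[i] n) (e_even : psl_part false e)
    (u : sl R[i] n) (u_lift : nilpotent_lift u e)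
    (u_type : jordan_type u lam) :
  psl_center (psl_centralizer e)
  = lspan [seq psl_pow u k | k <- iota 1 (head 0%N lam).-1].
Proof.
have [u0 _ <-] := u_lift; have [p [q [pJ qJ lamE]]] := u_type.
apply: psl_center_nilpotent => //.
  by rewrite (Num.Theory.pnatr_eq0 R[i]) -lt0n addn_gt0 (ltnW n_gt1).
have := all_geq_head_sort (p ++ q); rewrite -lamE all_cat => /andP[pN qN].
rewrite -u0 /hpart block_diag_exp.
rewrite (nilp_jordan_sizes_nilpotent pJ pN) (nilp_jordan_sizes_nilpotent qJ qN).
exact: block_mx0.
Qed.
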